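(* Let $\Theta$ be the Schottky group of a multiply connected circular domain $D_\zeta$ with $M\ge1$ holes, and let $\zeta,\alpha\in D_\zeta$ with $\zeta\neq\alpha$ (notation as in the context). Let $\delta$ be the Hausdorff dimension of the limit set of $\Theta$, assume $\delta\in(0,1)$, and let $C>0$ be the constant of Pollicott's counting theorem for $(\zeta,\alpha)$, i.e. the constant such that $$\mathrm{Card}\{\theta\in\Theta\setminus\{\mathrm{Id}\}:|R_{\zeta,\alpha}(\theta)-1|\ge 1/T\}\sim C\,T^{\delta}\qquad(T\to\infty).$$ Then $$\frac{|\omega_{U_{\max}}(\zeta,\alpha)-\omega(\zeta,\alpha)|}{|\omega(\zeta,\alpha)|}\;\le\;(1+o(1))\,\frac{C\,\delta}{1-\delta}\,e^{-(1-\delta)U_{\max}}\qquad\text{as }U_{\max}\to\infty.$$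
   Context: Domain. Fix $M\ge1$. Let $D_0=\{|z|<1\}$ and, for $m=1,\dots,M$, $D_m=\{z\in\mathbb{C}:|z-\delta_m|<q_m\}$ with $\delta_m\in\mathbb{C}$, $q_m>0$. Assume $\overline{D_i}\cap\overline{D_j}=\emptyset$ for $i\ne j$ and $\overline{D_i}\subset D_0$ for all $i$. Put $D_\zeta=D_0\setminus\bigcup_{m=1}^M\overline{D_m}$ (just the name of the domain). Schottky group. For $m=1,\dots,M$ let $\theta_m(z)=\delta_m+\dfrac{q_m^2z}{1-\overline{\delta_m}z}$, acting on the Riemann sphere, and $\theta_{-m}=\theta_m^{-1}$. $\Theta$ is the free group generated by $\theta_1,\dots,\theta_M$ under composition. $\Theta''$ denotes the quotient $(\Theta\setminus\{\mathrm{Id}\})/\!\sim$ with $\theta\sim\theta^{-1}$, identified with a choice of one representative from each pair $\{\theta,\theta^{-1}\}$ (the quantities below do not depend on the choice). Factors and potential. For $\theta\in\Theta\setminus\{\mathrm{Id}\}$, $$R_{\zeta,\alpha}(\theta)=\frac{(\theta(\zeta)-\alpha)(\theta(\alpha)-\zeta)}{(\theta(\zeta)-\zeta)(\theta(\alpha)-\alpha)}$$ (extended by continuity if $\theta(\zeta)$ or $\theta(\alpha)$ is $\infty$), and $U_{\zeta,\alpha}(\theta)=-\log|R_{\zeta,\alpha}(\theta)-1|$. Schottky–Klein prime function and its potential truncation: $$\omega(\zeta,\alpha)=(\zeta-\alpha)\prod_{\theta\in\Theta''}R_{\zeta,\alpha}(\theta),\qquad \omega_{U_{\max}}(\zeta,\alpha)=(\zeta-\alpha)\prod_{\theta\in\Theta'',\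 U_{\zeta,\alpha}(\theta)\le U_{\max}}R_{\zeta,\alpha}(\theta)\quad(U_{\max}>0).$$ Pollicott's counting theorem (a cited known result) asserts, for fixed $\zeta,\alpha\in D_\zeta$, the existence of a constant $C>0$ with the asymptotic stated in the claim, the exponent being the Hausdorff dimension $\delta$ of the limit set of $\Theta$. *)

(* Defs.v *)
From HB Require Import structures.
From mathcomp Require Import all_boot all_order all_algebra.
From mathcomp Require Import finmap.
From mathcomp Require Import complex.
From mathcomp Require Import all_classical all_reals all_analysis.
From mathcomp.analysis Require showcase.summability.

Set Implicit Arguments.
Unset Strict Implicit.
Unset Printing Implicit Defensive.

Import Order.TTheory GRing.Theory Num.Theory.
Import numFieldNormedType.Exports.

Local Open Scope classical_set_scope.
Local Open Scope ring_scope.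
Local Open Scope complex_scope.

(* [ComplexField.Normc.normc] is the modulus with values in R, whereas `|z| has
   values in R[i]. *)
Notation cmod := ComplexField.Normc.normc.

Section HausdorffDimension.
Context {R : realType} {X : Type} (d : X -> X -> R).
Local Open Scope ereal_scope.

(* Adding 0 gives the empty set diameter 0 instead of -oo. *)
Definition diameter (A : set X) : \bar R :=
  ereal_sup (0 |` [set (d x.1 x.2)%:E | x in A `*` A]).

Definition hausdorff_premeasure (s e : R) (A : set X) : \bar R :=
  ereal_inf [set \sum_(0 <= i <oo) diameter (U i) `^ s | U in
    [set U : nat -> set X |
      A `<=` \bigcup_i U i /\ forall i, diameter (U i) <= e%:E]].

Definition hausdorff_measure (s : R) (A : set X) : \bar R :=
  ereal_sup [set hausdorff_premeasure s e A | e in [set e : R | (0 < e)%R]].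

(* Restricting to s > 0 does not change the infimum and avoids 0 `^ 0. *)
Definition hausdorff_dim (A : set X) : \bar R :=
  ereal_inf [set s%:E | s in [set s : R | (0 < s)%R /\
                                          hausdorff_measure s A = 0]].

End HausdorffDimension.

Section UnorderedProduct.
Context {R : realType} {I : choiceType}.

Definition has_uprod (S : set I) (f : I -> R[i]) (p : R[i]) : Prop :=
  (fun A : {fset I} => cmod (\prod_(i <- A | i \in S) f i - p))
    @ summability.totally --> (0 : R).

(* The limit of the products over the finite subsets of S, ordered by
   inclusion; it is 1 when this limit does not exist. *)
Definition uprod (S : set I) (f : I -> R[i]) : R[i] :=
  xget 1 [set p | has_uprod S f p].

End UnorderedProduct.

Section CircularDomain.
Context {R : realType}.

Definition disc (c : R[i]) (r : R) : set R[i] := [set z | cmod (z - c) < r].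
Definition cdisc (c : R[i]) (r : R) : set R[i] := [set z | cmod (z - c) <= r].

Definition circular_data (M : nat) (ctr : 'I_M -> R[i]) (q : 'I_M -> R) : Prop :=
  [/\ forall m, 0 < q m,
      forall i j, i != j -> cdisc (ctr i) (q i) `&` cdisc (ctr j) (q j) = set0
    & forall i, cdisc (ctr i) (q i) `<=` disc 0 1].

Definition circular_domain (M : nat) (ctr : 'I_M -> R[i]) (q : 'I_M -> R)
    : set R[i] :=
  disc 0 1 `\` \bigcup_(m in [set: 'I_M]) cdisc (ctr m) (q m).

End CircularDomain.

Section SchottkyGroup.
Context {R : realType}.

(* The Riemann sphere: [None] is the point at infinity. *)
Definition sphere : Type := option R[i].

Definition chordal (u v : sphere) : R :=
  match u, v with
  | Some z, Some w =>
      2 * cmod (z - w) /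
        (Num.sqrt (1 + cmod z ^+ 2) * Num.sqrt (1 + cmod w ^+ 2))
  | Some z, None | None, Some z => 2 / Num.sqrt (1 + cmod z ^+ 2)
  | None, None => 0
  end.

(* delta + q^2 z / (1 - delta^* z), with its values at the pole and at
   infinity; for delta = 0 it is z |-> q^2 z, which fixes infinity. *)
Definition schottky_gen (delta : R[i]) (q : R) (u : sphere) : sphere :=
  match u with
  | Some z =>
      if 1 - conjc delta * z == 0 then None
      else Some (delta + (q ^+ 2)%:C * z / (1 - conjc delta * z))
  | None =>
      if delta == 0 then None else Some (delta - (q ^+ 2)%:C / conjc delta)
  end.

Definition inverse_maps (f g : sphere -> sphere) : Prop :=
  cancel f g /\ cancel g f.

Inductive schottky_group (M : nat) (ctr : 'I_M -> R[i]) (q : 'I_M -> R)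
    : (sphere -> sphere) -> Prop :=
| schottky_id : schottky_group ctr q id
| schottky_generator m : schottky_group ctr q (schottky_gen (ctr m) (q m))
| schottky_comp f g :
    schottky_group ctr q f -> schottky_group ctr q g ->
    schottky_group ctr q (f \o g)
| schottky_inv f g :
    schottky_group ctr q f -> inverse_maps f g -> schottky_group ctr q g.

Definition nontrivial_elements (M : nat) (ctr : 'I_M -> R[i]) (q : 'I_M -> R)
    : set (sphere -> sphere) :=
  [set th | schottky_group ctr q th /\ th <> id].

(* S contains exactly one element of each pair {th, th^-1}, th <> id. *)
Definition half_system (M : nat) (ctr : 'I_M -> R[i]) (q : 'I_M -> R)
    (S : set (sphere -> sphere)) : Prop :=
  S `<=` nontrivial_elements ctr q /\
  forall th, nontrivial_elements ctr q th ->
    exists! s, S s /\ (s = th \/ inverse_maps th s).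

(* The accumulation points of orbits under infinitely many group elements. *)
Definition limit_set (M : nat) (ctr : 'I_M -> R[i]) (q : 'I_M -> R)
    : set sphere :=
  [set w | exists z (f : nat -> sphere -> sphere),
     [/\ forall n, schottky_group ctr q (f n), injective f
       & chordal (f n z) w @[n --> \oo] --> (0 : R)]].

End SchottkyGroup.
Arguments sphere R : clear implicits.

Section PrimeFunction.
Context {R : realType}.

(* (u - a) / (u - b), continuously extended to u = infinity. *)
Definition sphere_ratio (u : sphere R) (a b : R[i]) : R[i] :=
  if u is Some w then (w - a) / (w - b) else 1.

Definition Rfactor (zeta alpha : R[i]) (th : sphere R -> sphere R) : R[i] :=
  sphere_ratio (th (Some zeta)) alpha zeta *
  sphere_ratio (th (Some alpha)) zeta alpha.

(* Extended-real valued: +oo when the factor is 1. *)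
Definition potential (zeta alpha : R[i]) (th : sphere R -> sphere R) : \bar R :=
  (- lne (cmod (Rfactor zeta alpha th - 1))%:E)%E.

(* The parameter S is meant to be a [half_system]. *)
Definition prime_function (S : set (sphere R -> sphere R)) (zeta alpha : R[i])
    : R[i] :=
  (zeta - alpha) * uprod S (Rfactor zeta alpha).

Definition prime_function_trunc (S : set (sphere R -> sphere R)) (Umax : R)
    (zeta alpha : R[i]) : R[i] :=
  (zeta - alpha) *
  uprod (S `&` [set th | (potential zeta alpha th <= Umax%:E)%E])
        (Rfactor zeta alpha).

(* [fset_set] sends infinite sets to fset0. *)
Definition factor_count (M : nat) (ctr : 'I_M -> R[i]) (q : 'I_M -> R)
    (zeta alpha : R[i]) (T : R) : nat :=
  #|` fset_set [set th | nontrivial_elements ctr q th /\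
                         T^-1 <= cmod (Rfactor zeta alpha th - 1)] |.

End PrimeFunction.

(* Main.v *)
Require Import Defs.
From HB Require Import structures.
From mathcomp Require Import all_boot all_order all_algebra.
From mathcomp Require Import finmap.
From mathcomp Require Import complex.
From mathcomp Require Import all_classical all_reals all_analysis.
From mathcomp.analysis Require showcase.summability.
From mathcomp Require Import lra ring.

Set Implicit Arguments.
Unset Strict Implicit.
Unset Printing Implicit Defensive.

Import Order.TTheory GRing.Theory Num.Theory.
Import numFieldNormedType.Exports.
Import ComplexField.Normc.
Local Open Scope classical_set_scope.
Local Open Scope ring_scope.

(** Put a(th) = |R(th) - 1| and N(T) = Card {th <> Id : a(th) >= 1/T}, so that
    N(T) ~ C T^delta with delta < 1. The relative truncation error is to first
    order at most the sum of the a(th) < 1/T for T = exp U, and the asymptotics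
    of N determine how large this sum can be.

    Tail sums of a. List the elements with a(th) < 1/T by decreasing a. The
    k-th one, together with its predecessors and the N(T) elements above the
    level 1/T, is counted by N(1/a_k), so N(T) + k <= N(1/a_k) <= K a_k^(-delta)
    with K close to C. Hence a_k <= (K / (N(T) + k))^p, p = 1/delta > 1, and
    comparing the sum of (N(T) + k)^(-p) with the integral of x^(-p) from N(T)
    to infinity gives
      sum a_k <= K^p / (p - 1) * N(T)^(1 - p)
              ~ C delta / (1 - delta) * T^(delta - 1)
    ([sum_below_le], [sum_below_asymp]). This is the value that integration by
    parts of dN(t) / t from T to infinity predicts.

    Products. If the values |f i - 1| outside a finite set F have all their
    finite sums at most s, then adding finitely many factors to the product
    over F changes it by a relative amount at most exp s - 1
    ([cmod_prod_sub1], [pprod_near]). Applied with s -> 0 this is the Cauchy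
    criterion, so the infinite product exists ([ex_has_uprod]); applied with
    F the set of factors of potential at most U, it bounds the relative
    truncation error by s / (1 - 2 s) = (1 + o(1)) s
    ([relative_truncation_error]). With T = exp U the two parts combine into
    [uprod_truncation_error]: for each c > 1 the error is eventually at most c
    times the main term. The function h of the theorem is the relative excess
    of the error over the main term, cut off below at 0.

    Summing over a half system is bounded by summing over all nontrivial
    elements. *)

(** * Tail sums of a family with a given counting function *)

(** The comparison of (m + 1)^(-p) with the integral of x^(-p) over [m, m + 1],
    in the form that telescopes. Dividing by (m + 1)^(1 - p) turns it into
    Bernoulli's inequality for the exponent 1 - p at m / (m + 1). *)
Lemma powR_telescope (R : realType) (p m : R) : 1 < p -> 0 < m ->
  (m + 1) `^ (- p) <= (m `^ (1 - p) - (m + 1) `^ (1 - p)) / (p - 1).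
Proof.
move=> p1 m0; have m1 : 0 < m + 1 by lra.
have p10 : 0 < p - 1 by lra.
have -> : (m + 1) `^ (- p) = (m + 1) `^ (1 - p) / (m + 1).
  rewrite -{3}[m + 1](powRr1 (ltW m1)) -powRB; first by congr (_ `^ _); ring.
  by apply/implyP => _; rewrite gt_eqF.
have -> : m `^ (1 - p) = (m + 1) `^ (1 - p) * (m / (m + 1)) `^ (1 - p).
  rewrite -powRM ?divr_ge0 ?ltW//; congr (_ `^ _).
  by field; rewrite gt_eqF.
rewrite ler_pdivlMr//.
rewrite -{3}[(m + 1) `^ (1 - p)]mulr1 -mulrBr -mulrA ler_wpM2l ?powR_ge0//.
have x0 : 0 < m / (m + 1) by rewrite divr_gt0.
rewrite /powR gt_eqF//.
have lnx : ln (m / (m + 1)) <= - (m + 1)^-1.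
  have -> : m / (m + 1) = 1 + - (m + 1)^-1 by field; rewrite gt_eqF.
  by apply: le_ln1Dx; rewrite ltrN2 invf_lt1//; lra.
have := expR_ge1Dx ((1 - p) * ln (m / (m + 1))).
have := ler_wpM2l (ltW p10) lnx.
by lra.
Qed.

Section Tail.
Context {R : realType} {I : choiceType}.
Variables (a : I -> R) (D : set I).
Hypothesis a_ge0 : forall i, 0 <= a i.

Definition level (T : R) : set I := [set i | D i /\ T^-1 <= a i].
Definition level_count (T : R) : R := (#|` fset_set (level T)|)%:R.
Definition below (T : R) : set I := [set i | D i /\ a i < T^-1].

Lemma levelS (t T : R) : 0 < T -> T <= t -> level T `<=` level t.
Proof.
move=> T0 Tt i [Di ai]; split=> //; apply: le_trans ai.
by rewrite lef_pV2 ?posrE// (lt_le_trans T0).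
Qed.

(** Lowering the level from 1/T to x picks up all of A in addition to what was
    already counted; applied with x the minimum of a on A, this turns an upper
    bound on the counting function into an upper bound on that minimum. *)
Lemma count_below_min (T x : R) (A : {fset I}) : 0 < T -> 0 < x -> x < T^-1 ->
  finite_set (level x^-1) -> [set` A] `<=` below T ->
  (forall i, i \in A -> x <= a i) ->
  level_count T + (#|` A|)%:R <= level_count x^-1.
Proof.
move=> T0 x0 xT fin Ab xa.
have xT' : T <= x^-1.
  by rewrite -[T]invrK lef_pV2 ?posrE ?invr_gt0// ltW.
have finT : finite_set (level T).
  exact: sub_finite_set (levelS T0 xT') fin.
rewrite /level_count -natrD ler_nat.
have disj : [disjoint fset_set (level T) & A]%fset.
  apply/fdisjointP => i; rewrite in_fset_set// inE => -[_ Ti].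
  by apply/negP => /Ab[_]; rewrite ltNge Ti.
have <- : #|` (fset_set (level T) `|` A)%fset| =
    (#|` fset_set (level T)| + #|` A|)%N.
  by move: disj; rewrite -cardfsUI -fsetI_eq0 => /eqP ->; rewrite cardfs0 addn0.
apply/fsubset_leq_card/fsubsetP => i.
rewrite in_fsetU !in_fset_set// => /orP[/set_mem iT|iA]; apply/mem_set.
  exact: levelS iT.
split; first by have [] := Ab i iA.
by rewrite invrK xa.
Qed.

(** The values of a on A are exhausted from the smallest one: when A has k + 1
    elements, its minimum is at most (K / (N(T) + k + 1))^p, and
    [powR_telescope] absorbs this term into the bound for the other k. The
    negative term keeps the bound exact enough for the induction. *)
Lemma sum_below_le (p K T : R) (A : {fset I}) : 1 < p -> 0 <= K -> 0 < T ->
  (forall t, T <= t -> finite_set (level t)) ->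
  (forall t, T <= t -> level_count t <= K * t `^ p^-1) ->
  0 < level_count T -> [set` A] `<=` below T ->
  \sum_(i <- A) a i <= K `^ p / (p - 1) *
    (level_count T `^ (1 - p) - (level_count T + (#|` A|)%:R) `^ (1 - p)).
Proof.
move=> p1 K0 T0 fin cntK N0.
have p0 : 0 < p by lra.
have [n An] := ubnP #|` A|; elim: n A An => // n IH A An Ab.
have [->|/fset0Pn[j jA]] := eqVneq A fset0.
  by rewrite big_seq_fset0 cardfs0 addr0 subrr mulr0.
have [i iA imin] : exists2 i, i \in A & forall j, j \in A -> a i <= a j.
  have [i _ imin] := @arg_minP _ _ _ [` jA]%fset xpredT (fun i => a (val i)) isT.
  exists (val i); first exact: valP.
  by move=> k kA; exact: (imin [` kA]%fset).
have cA : #|` A| = (#|` A `\ i|%fset).+1 by rewrite (cardfsD1 i) iA.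
rewrite (big_fsetD1 i iA) /=.
have Bb : [set` (A `\ i)%fset] `<=` below T.
  by move=> k /= /fsetD1P[_ kA]; exact: Ab.
have := IH (A `\ i)%fset; rewrite cA in An; move=> /(_ An Bb).
set B := \sum_(k <- _) _ => HB.
set m := level_count T + (#|` A `\ i|%fset)%:R in HB *.
have -> : level_count T + (#|` A|)%:R = m + 1.
  by rewrite cA -natr1 addrA.
have m0 : 0 < m by have := ler0n R #|` A `\ i|%fset; rewrite /m; lra.
have m1 : 0 < m + 1 by rewrite ltr_wpDr.
have ai : a i <= K `^ p * (m + 1) `^ (- p).
  (* A vanishing minimum is never counted at any level, but satisfies the bound. *)
  have := a_ge0 i; rewrite le_eqVlt => /predU1P[<-|ai0].
    by rewrite mulr_ge0// powR_ge0.
  have aiT : a i < T^-1 by have [] := Ab i iA.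
  have Ti : T <= (a i)^-1.
    by rewrite -[T]invrK lef_pV2 ?posrE ?invr_gt0// ltW.
  have := count_below_min T0 ai0 aiT (fin _ Ti) Ab imin.
  rewrite cA -natr1 addrA -/m => /le_trans/(_ (cntK _ Ti)) h.
  have {}h : (m + 1) * a i `^ p^-1 <= K.
    move: h; rewrite -(powR_inv1 (ltW ai0)) -powRrM mulN1r [_ `^ (- p^-1)]powRN.
    by rewrite ler_pdivlMr ?powR_gt0.
  rewrite powRN ler_pdivlMr ?powR_gt0//.
  have -> : a i * (m + 1) `^ p = ((m + 1) * a i `^ p^-1) `^ p.
    rewrite powRM ?powR_ge0 ?(ltW m1)// -powRrM mulVf ?gt_eqF//.
    by rewrite powRr1 ?ltW// mulrC.
  by apply: ge0_ler_powR; rewrite ?nnegrE ?mulr_ge0 ?powR_ge0 ?(ltW m1) ?(ltW p0).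
apply: (le_trans (lerD ai HB)).
have /(ler_wpM2l (powR_ge0 K p)) := powR_telescope p1 m0.
by lra.
Qed.

End Tail.

Section Asymptotics.
Context {R : realType} {I : choiceType}.
Variables (a : I -> R) (D : set I).
Hypothesis a_ge0 : forall i, 0 <= a i.
Variables (delta C : R).
Hypotheses (delta01 : 0 < delta < 1) (C0 : 0 < C).
Hypothesis countP : level_count a D T / (C * T `^ delta) @[T --> +oo] --> (1 : R).

Lemma count_between (b : R) : 1 < b -> \forall T \near +oo,
  b^-1 * (C * T `^ delta) <= level_count a D T /\
  level_count a D T <= b * (C * T `^ delta).
Proof.
move=> b1; near=> T.
have T0 : 0 < T by near: T; apply: nbhs_pinfty_gt; rewrite num_real.
have CT : 0 < C * T `^ delta by rewrite mulr_gt0 ?powR_gt0.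
split.
  rewrite -ler_pdivlMr//; near: T; apply: (cvgr_ge _ countP).
  by rewrite invf_lt1//; lra.
by rewrite -ler_pdivrMr//; near: T; exact: (cvgr_le _ countP).
Unshelve. all: by end_near. Qed.

(** An infinite level set would be counted as 0, and so would all the larger
    ones, whereas the asymptotics make the count eventually positive. *)
Lemma finite_level (T : R) : 0 < T -> finite_set (level a D T).
Proof.
move=> T0.
have Npos : \forall t \near +oo, 0 < level_count a D t.
  have b1 : (1 : R) < 2 by lra.
  near=> t.
  have t0 : 0 < t by near: t; apply: nbhs_pinfty_gt; rewrite num_real.
  suff [lo _] : 2^-1 * (C * t `^ delta) <= level_count a D t /\
      level_count a D t <= 2 * (C * t `^ delta).
    by apply: lt_le_trans lo; rewrite !mulr_gt0 ?powR_gt0 ?invr_gt0.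
  by near: t; exact: count_between.
have [t []] : exists t, T <= t /\ 0 < level_count a D t.
  suff : \forall t \near +oo, T <= t /\ 0 < level_count a D t by exact: filter_ex.
  by apply: filterI => //; apply: nbhs_pinfty_ge; rewrite num_real.
move=> Tt Nt; apply: (sub_finite_set (levelS T0 Tt)).
apply: contrapT => inf; move: Nt.
by rewrite /level_count /fset_set; case: pselect => //= _; rewrite ?cardfs0 ltxx.
Unshelve. all: by end_near. Qed.

(** [sum_below_le] for K = b C and N(T) >= C T^delta / b, where b > 1 is chosen
    so that the total loss b^p * b^(p - 1) is exactly c. *)
Lemma sum_below_asymp (c : R) : 1 < c -> \forall T \near +oo,
  forall A : {fset I}, [set` A] `<=` below a D T ->
  \sum_(i <- A) a i <= c * (C * delta / (1 - delta)) * T `^ (delta - 1).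
Proof.
move=> c1; have /andP[d0 d1] := delta01.
pose p := delta^-1.
have p1 : 1 < p by rewrite invf_gt1.
have q0 : 0 < p + p - 1 by lra.
pose b := c `^ (p + p - 1)^-1.
have b1 : 1 < b.
  rewrite /b /powR gt_eqF; last by lra.
  by rewrite expR_gt1 mulr_gt0 ?invr_gt0// ln_gt0.
have b0 : 0 < b by lra.
have bc : b `^ p * b `^ (p - 1) = c.
  rewrite -powRD; last by apply/implyP => _; rewrite gt_eqF.
  by rewrite addrA -powRrM mulVf ?gt_eqF// powRr1//; lra.
clearbody b.
have [M [_ Mb]] := count_between b1.
near=> T => A Ab.
have T0 : 0 < T by near: T; apply: nbhs_pinfty_gt; rewrite num_real.
have MT : M < T by near: T; apply: nbhs_pinfty_gt; rewrite num_real.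
have CT : 0 < C * T `^ delta by rewrite mulr_gt0 ?powR_gt0.
have [lo _] := Mb _ MT.
have bCT : 0 < b^-1 * (C * T `^ delta) by rewrite mulr_gt0 ?invr_gt0.
have N0 := lt_le_trans bCT lo.
have bC : 0 <= b * C by rewrite mulr_ge0 ?ltW.
have fin t : T <= t -> finite_set (level a D t).
  by move=> Tt; apply: finite_level; exact: lt_le_trans Tt.
have up t : T <= t -> level_count a D t <= b * C * t `^ p^-1.
  by move=> Tt; rewrite /p invrK -mulrA; have [] := Mb _ (lt_le_trans MT Tt).
apply: (le_trans (sum_below_le a_ge0 p1 bC T0 fin up N0 Ab)).
set N := level_count a D T in lo N0 *.
have N1 : N `^ (1 - p) <= (b^-1 * (C * T `^ delta)) `^ (1 - p).
  rewrite -opprB !powRN lef_pV2 ?posrE ?powR_gt0//.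
  by apply: ge0_ler_powR; rewrite ?nnegrE ?(ltW bCT) ?(ltW N0) ?subr_ge0 ?(ltW p1).
have -> : c * (C * delta / (1 - delta)) * T `^ (delta - 1) =
    (b * C) `^ p / (p - 1) * (b^-1 * (C * T `^ delta)) `^ (1 - p).
  rewrite !powRM ?mulr_ge0 ?powR_ge0 ?invr_ge0 ?(ltW b0) ?(ltW C0)//.
  rewrite -(powR_inv1 (ltW b0)) -!powRrM mulN1r opprB.
  have -> : delta * (1 - p) = delta - 1.
    by rewrite mulrBr mulr1 /p divff// gt_eqF.
  have -> : C `^ (1 - p) = C / C `^ p.
    rewrite -{2}(powRr1 (ltW C0)) -powRB//.
    by apply/implyP => _; rewrite gt_eqF.
  have -> : (p - 1)^-1 = delta / (1 - delta).
    have dN0 : delta != 0 by rewrite gt_eqF.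
    have dN1 : 1 - delta != 0 by rewrite subr_eq0 gt_eqF.
    by rewrite /p; field; rewrite dN1 dN0.
  have dN1 : 1 - delta != 0 by rewrite subr_eq0 gt_eqF.
  rewrite -bc; field.
  by rewrite dN1 gt_eqF ?powR_gt0.
apply: ler_wpM2l.
  by rewrite divr_ge0 ?powR_ge0//; lra.
apply: le_trans N1; rewrite lerBlDr lerDl; exact: powR_ge0.
Unshelve. all: by end_near. Qed.

End Asymptotics.

(** * Finite products of complex numbers close to 1 *)

Section Modulus.
Context {R : realType}.
Implicit Types z w : R[i].

Lemma cmod_ge0 z : 0 <= cmod z.
Proof. by case: z => x y; exact: sqrtr_ge0. Qed.

Lemma cmodN z : cmod (- z) = cmod z.
Proof. exact: normcN. Qed.

Lemma cmod_distC z w : cmod (z - w) = cmod (w - z).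
Proof. by rewrite -cmodN opprB. Qed.

Lemma cmodD_le z w : cmod (z + w) <= cmod z + cmod w.
Proof. exact: le_normcD. Qed.

Lemma cmod_dist_trans u z w : cmod (z - w) <= cmod (z - u) + cmod (u - w).
Proof. by rewrite -[z - w](subrKA u) cmodD_le. Qed.

Lemma cmod_Re z : `|complex.Re z| <= cmod z.
Proof. by case: z => x y /=; rewrite -sqrtr_sqr ler_wsqrtr// lerDl sqr_ge0. Qed.

Lemma cmod_Im z : `|complex.Im z| <= cmod z.
Proof. by case: z => x y /=; rewrite -sqrtr_sqr ler_wsqrtr// lerDr sqr_ge0. Qed.

Lemma cmod_le_ReIm z : cmod z <= `|complex.Re z| + `|complex.Im z|.
Proof.
case: z => x y /=.
rewrite -[leRHS]ger0_norm ?addr_ge0// -sqrtr_sqr ler_wsqrtr// sqrrD.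
rewrite !real_normK ?num_real//.
by rewrite lerD2r lerDl mulrn_wge0// mulr_ge0.
Qed.

Lemma cmod_prod_sub1 (I : Type) (s : seq I) (P : pred I) (f : I -> R[i]) :
  cmod (\prod_(i <- s | P i) f i - 1) <=
  expR (\sum_(i <- s | P i) cmod (f i - 1)) - 1.
Proof.
elim: s => [|i s IH]; first by rewrite !big_nil subrr expR0 subrr normc0.
rewrite !big_cons; case: (P i) => //.
move: IH; set z := \prod_(j <- s | P j) f j.
set x := \sum_(j <- s | P j) _ => IH.
have -> : f i * z - 1 = (f i - 1) * z + (z - 1) by ring.
apply: (le_trans (cmodD_le _ _)); rewrite normcM expRD.
have zx : cmod z <= expR x.
  rewrite -[z](subrK 1); apply: (le_trans (cmodD_le _ _)).
  by rewrite normc1 -lerBrDr.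
have := ler_wpM2r (expR_ge0 x) (expR_ge1Dx (cmod (f i - 1))).
have := ler_wpM2l (cmod_ge0 (f i - 1)) zx.
by lra.
Qed.

End Modulus.

(** * Unordered infinite products *)

Section UnorderedProducts.
Context {R : realType} {I : choiceType}.
Variables (S : set I) (f : I -> R[i]).

Local Notation pprod A := (\prod_(i <- A | i \in S) f i).

(** The family of the |f i - 1| over S minus F is summable with sum at most s,
    expressed by finite sums only so that no summability has to be assumed. *)
Definition tail_sum_le (F : {fset I}) (s : R) : Prop :=
  forall B : {fset I}, [set` B] `<=` S -> [disjoint B & F]%fset ->
  \sum_(i <- B) cmod (f i - 1) <= s.

Lemma pprod_near (F A : {fset I}) (s : R) : tail_sum_le F s -> (F `<=` A)%fset ->
  cmod (pprod A - pprod F) <= cmod (pprod F) * (expR s - 1).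
Proof.
move=> Fs FA.
have -> : pprod A = pprod F * pprod (A `\` F)%fset.
  rewrite (big_fsetIDcond _ (mem F)) /=.
  have -> : [fset x in A | x \in F]%fset = F.
    apply/fsetP => i; rewrite !inE /=.
    by case: (boolP (i \in F)) => [/(fsubsetP FA) ->|]//; rewrite andbF.
  suff -> : [fset x in A | x \notin F]%fset = (A `\` F)%fset by [].
  by apply/fsetP => i; rewrite !inE /= andbC.
rewrite -{2}[pprod F]mulr1 -mulrBr normcM ler_wpM2l ?cmod_ge0//.
apply: (le_trans (cmod_prod_sub1 _ _ _)); rewrite lerD2r ler_expR.
rewrite big_fset_condE; apply: Fs.
  by move=> i /=; rewrite !inE/= => /andP[_ /set_mem].
by apply/fdisjointP => i; rewrite !inE/= => /andP[/andP[]].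
Qed.

#[local] Existing Instance summability.totally_filter.

Lemma near_totally (F : {fset I}) :
  \forall A \near summability.totally, (F `<=` A)%fset.
Proof. by exists F. Qed.

(** The net of finite products is Cauchy: past a first set F1 its values are
    bounded by some P, and past a set with a tail at most ln (1 + e / (P + 1))
    they move by at most P * e / (P + 1) <= e. Completeness is used on the real
    and imaginary parts separately. *)
Lemma ex_has_uprod :
  (forall e : R, 0 < e -> exists F, tail_sum_le F e) -> exists p, has_uprod S f p.
Proof.
move=> tails.
have approx (e : R) : 0 < e ->
    exists F, forall A, (F `<=` A)%fset -> cmod (pprod A - pprod F) <= e.
  move=> e0; have [F1 F1s] := tails 1 ltr01.
  pose P := cmod (pprod F1) * expR 1.
  have P0 : 0 <= P by rewrite mulr_ge0 ?cmod_ge0 ?expR_ge0.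
  have bd A : (F1 `<=` A)%fset -> cmod (pprod A) <= P.
    move=> /(pprod_near F1s) h.
    rewrite -[pprod A](subrK (pprod F1)); apply: (le_trans (cmodD_le _ _)).
    by move: h; rewrite /P; lra.
  pose s := ln (1 + e / (P + 1)).
  have eP : 0 < e / (P + 1) by rewrite divr_gt0//; lra.
  have s0 : 0 < s by rewrite ln_gt0//; lra.
  have [F2 F2s] := tails s s0.
  have F12 : tail_sum_le (F1 `|` F2)%fset s.
    move=> B BS; rewrite fdisjointXU => /andP[_]; exact: F2s.
  exists (F1 `|` F2)%fset => A /(pprod_near F12)/le_trans; apply.
  rewrite /s lnK ?posrE; last by lra.
  have -> : 1 + e / (P + 1) - 1 = e / (P + 1) by ring.
  have /(ler_wpM2r (ltW eP))/le_trans := bd _ (fsubsetUl F1 F2); apply.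
  rewrite mulrA ler_pdivrMr; last by lra.
  by nra.
have conv (g : R[i] -> R) :
    (forall z w, `|g z - g w| <= cmod (z - w)) ->
    exists l, (fun A : {fset I} => g (pprod A)) @ summability.totally --> (l : R).
  move=> gL.
  suff : cvg ((fun A : {fset I} => g (pprod A)) @ summability.totally).
    by move=> /cvg_ex.
  apply/cauchy_cvgP/cauchy_exP => e e0.
  have [F Fe] := approx (e / 2) (divr_gt0 e0 (ltr0n _ 2)).
  exists (g (pprod F)); apply: filterS (near_totally F) => A /Fe Ae.
  rewrite /ball /= /ball_ distrC; apply: (le_lt_trans (gL _ _)).
  by apply: (le_lt_trans Ae); lra.
have [x ux] : exists l, (fun A : {fset I} => complex.Re (pprod A))
    @ summability.totally --> (l : R).
  by apply: conv => z w; rewrite -raddfB; exact: cmod_Re.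
have [y uy] : exists l, (fun A : {fset I} => complex.Im (pprod A))
    @ summability.totally --> (l : R).
  by apply: conv => z w; rewrite -raddfB; exact: cmod_Im.
exists (x +i* y)%C; rewrite /has_uprod.
apply/cvgr0Pnorm_le => e e0; near=> A.
rewrite ger0_norm ?cmod_ge0//; apply: (le_trans (cmod_le_ReIm _)).
rewrite [e]splitr lerD//.
  rewrite raddfB /= distrC; near: A.
  by apply: cvgr_dist_le ux _ _; rewrite divr_gt0.
rewrite raddfB /= distrC; near: A.
by apply: cvgr_dist_le uy _ _; rewrite divr_gt0.
Unshelve. all: by end_near. Qed.

Lemma has_uprod_near (p : R[i]) (F : {fset I}) (s : R) :
  has_uprod S f p -> tail_sum_le F s ->
  cmod (pprod F - p) <= cmod (pprod F) * (expR s - 1).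
Proof.
move=> fp Fs; apply/ler_addgt0Pr => e e0.
have : \forall A \near summability.totally,
    (F `<=` A)%fset /\ `|cmod (pprod A - p)| <= e.
  by apply: filterI; [exact: near_totally|exact: cvgr0_norm_le fp _ e0].
move=> /filter_ex[A [FA]]; rewrite ger0_norm ?cmod_ge0// => Ae.
apply: (le_trans (cmod_dist_trans (pprod A) _ _)); rewrite lerD//.
by rewrite cmod_distC; exact: pprod_near.
Qed.

(** Here |pF - p| <= |pF| (exp s - 1) <= |pF| s / (1 - s), and |pF| is at most
    |pF - p| + |p|; solving for |pF - p| gives the quotient s / (1 - 2 s). *)
Lemma relative_truncation_error (p : R[i]) (F : {fset I}) (s : R) :
  has_uprod S f p -> tail_sum_le F s -> p != 0 -> s < 2^-1 ->
  cmod (pprod F - p) / cmod p <= s / (1 - 2 * s).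
Proof.
move=> fp Fs p0 s12.
have s0 : 0 <= s.
  have := Fs fset0; rewrite big_seq_fset0; apply; first by move=> i.
  exact: fdisjoint0X.
have := has_uprod_near fp Fs.
have : cmod (pprod F) <= cmod (pprod F - p) + cmod p.
  by rewrite -{1}[pprod F](subrK p) cmodD_le.
have cp : 0 < cmod p.
  by rewrite lt_neqAle cmod_ge0 andbT eq_sym; apply: contra_neq p0; exact: eq0_normc.
set d := cmod (_ - _); set P := cmod (pprod F); set c := cmod p in cp * => h1 h2.
have P0 : 0 <= P by exact: cmod_ge0.
have es : expR s * (1 - s) <= 1.
  rewrite -(@ler_pM2r _ (expR (- s))) ?expR_gt0//.
  rewrite mul1r mulrAC -expRD subrr expR0 mul1r.
  exact: expR_ge1Dx.
have {}es : (expR s - 1) * (1 - s) <= s by lra.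
have s1 : 0 < 1 - s by lra.
have h3 : d * (1 - s) <= P * s.
  have := ler_wpM2r (ltW s1) h2; rewrite -mulrA.
  by have := ler_wpM2l P0 es; lra.
rewrite ler_pdivrMr// mulrAC ler_pdivlMr; last by lra.
by have := ler_wpM2r s0 h1; lra.
Qed.

Lemma uprodP (p : R[i]) : has_uprod S f p -> has_uprod S f (uprod S f).
Proof. by move=> fp; exact: (xgetPex 1 (ex_intro _ p fp)). Qed.

(** Over a finite set the tail is empty, so any limit of the finite products is
    at distance 0 from the full product. *)
Lemma uprod_finite (F : {fset I}) : S `<=` [set` F] -> uprod S f = pprod F.
Proof.
move=> SF; have F0 : tail_sum_le F 0.
  move=> B BS /fdisjointP BF; rewrite big_seq big1// => i iB.
  by have := BF _ iB; rewrite (SF _ (BS _ iB)).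
have [p /uprodP fp] : exists p, has_uprod S f p.
  apply: ex_has_uprod => e e0; exists F => B BS BF.
  exact: le_trans (F0 B BS BF) (ltW e0).
have := has_uprod_near fp F0; rewrite expR0 subrr mulr0 => h.
apply/esym/eqP; rewrite -subr_eq0; apply/eqP/eq0_normc/eqP.
by rewrite eq_le h cmod_ge0.
Qed.

End UnorderedProducts.

(** * The truncation error as the cut-off tends to infinity *)

Section Truncation.
Context {R : realType}.

Lemma near_expRN_le (r K e : R) : 0 < r -> 0 <= K -> 0 < e ->
  \forall U \near +oo, K * expR (- (r * U)) <= e.
Proof.
move=> r0 K0 e0; near=> U.
have KU : K / e / r <= U by near: U; apply: nbhs_pinfty_ge; rewrite num_real.
rewrite expRN ler_pdivrMr ?expR_gt0//.
move: KU; rewrite ler_pdivrMr// ler_pdivrMr// => KU.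
have := ler_wpM2l (ltW e0) (expR_ge1Dx (r * U)).
by lra.
Unshelve. all: by end_near. Qed.

Lemma near_expR (P : R -> Prop) :
  (\forall T \near +oo, P T) -> \forall U \near +oo, P (expR U).
Proof.
move=> [M [_ PM]]; near=> U.
have MU : M < U by near: U; apply: nbhs_pinfty_gt; rewrite num_real.
by apply: PM; have := expR_ge1Dx U; lra.
Unshelve. all: by end_near. Qed.

(** Turns an estimate that holds up to each factor c > 1 into one with a single
    factor 1 + o(1). *)
Lemma cvg0_relative_excess (E G : R -> R) : (forall U, 0 < G U) ->
  (forall c, 1 < c -> \forall U \near +oo, E U <= c * G U) ->
  exists2 h : R -> R, h U @[U --> +oo] --> (0 : R) &
    \forall U \near +oo, E U <= (1 + h U) * G U.
Proof.
move=> G0 EG; exists (fun U => Num.max 0 (E U / G U - 1)); last first.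
  by near=> U; rewrite -ler_pdivrMr// addrC -lerBlDr le_max lexx orbT.
apply/cvgr0Pnorm_le => e e0; near=> U.
rewrite ger0_norm ?le_max ?lexx// ge_max ltW//= lerBlDr ler_pdivrMr//.
by rewrite addrC; near: U; apply: EG; lra.
Unshelve. all: by end_near. Qed.

Context {I : choiceType}.
Variables (S D : set I) (f : I -> R[i]) (delta C : R).
Hypothesis SD : S `<=` D.
Let a i := cmod (f i - 1).
Hypotheses (delta01 : 0 < delta < 1) (C0 : 0 < C).
Hypothesis countP : level_count a D T / (C * T `^ delta) @[T --> +oo] --> (1 : R).

Let a_ge0 i : 0 <= a i. Proof. exact: cmod_ge0. Qed.

Lemma tail_level (c : R) : 1 < c -> \forall U \near +oo,
  tail_sum_le S f (fset_set (S `&` level a D (expR U)))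
    (c * (C * delta / (1 - delta)) * expR (- ((1 - delta) * U))).
Proof.
move=> /(sum_below_asymp a_ge0 delta01 C0 countP)/near_expR.
apply: filterS => U h B BS BF.
have fin : finite_set (S `&` level a D (expR U)).
  apply: (@sub_finite_set _ _ (level a D (expR U))); first exact: subIsetr.
  exact: (finite_level C0 countP (expR_gt0 U)).
have -> : expR (- ((1 - delta) * U)) = expR U `^ (delta - 1).
  by rewrite -expRM; congr expR; ring.
apply: h => i /= iB; split; first exact/SD/BS.
rewrite ltNge; apply/negP => ai.
have /fdisjointP/(_ _ iB)/negP := BF; apply.
by rewrite in_fset_set//; apply/mem_set; split; [exact: BS|split=> //; exact/SD/BS].
Qed.

(** One factor b = sqrt c is spent on the asymptotics of the tail sum s, the
    other on 1 / (1 - 2 b s), which is at most b once s is small. *)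
Lemma uprod_truncation_error (c : R) : 1 < c -> \forall U \near +oo,
  cmod (uprod (S `&` [set i | expR (- U) <= a i]) f - uprod S f)
    / cmod (uprod S f)
  <= c * (C * delta / (1 - delta) * expR (- ((1 - delta) * U))).
Proof.
move=> c1; have /andP[d0 d1] := delta01.
have K0 : 0 < C * delta / (1 - delta) by rewrite divr_gt0 ?mulr_gt0//; lra.
set K := C * delta / (1 - delta) in K0 *.
have r0 : 0 < 1 - delta by lra.
have [p0] : exists p, has_uprod S f p.
  apply: ex_has_uprod => e e0.
  have : \forall U \near +oo, 2 * K * expR (- ((1 - delta) * U)) <= e /\
      tail_sum_le S f (fset_set (S `&` level a D (expR U)))
        (2 * K * expR (- ((1 - delta) * U))).
    apply: filterI; first by apply: near_expRN_le => //; lra.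
    by apply: tail_level; lra.
  move=> /filter_ex[U [Ue tail]].
  exists (fset_set (S `&` level a D (expR U))) => B BS BF.
  exact: le_trans (tail B BS BF) Ue.
move=> /uprodP; set p := uprod S f => fp.
(* For a vanishing product the quotient is 0 by the convention 1 / 0 = 0. *)
have [p00|pN0] := eqVneq p 0.
  near=> U; rewrite p00 normc0 invr0 mulr0.
  by apply: mulr_ge0; [lra|apply: mulr_ge0; [exact: ltW|exact: expR_ge0]].
pose b := Num.sqrt c.
have bb : b * b = c by rewrite -expr2 sqr_sqrtr//; lra.
have b1 : 1 < b by rewrite -sqrtr1 ltr_sqrt//; lra.
have bV1 : b^-1 < 1 by rewrite invf_lt1//; lra.
have bV0 : 0 < b^-1 by rewrite invr_gt0; lra.
have bK : 0 <= b * K by apply: mulr_ge0; [lra|exact: ltW].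
near=> U.
set s := K * expR (- ((1 - delta) * U)).
have s0 : 0 < s by apply: mulr_gt0 => //; exact: expR_gt0.
have tail : tail_sum_le S f (fset_set (S `&` level a D (expR U))) (b * s).
  by rewrite /s mulrA; near: U; exact: tail_level.
have s_small : b * s <= (1 - b^-1) / 2.
  by rewrite /s mulrA; near: U; apply: near_expRN_le => //; lra.
have -> : S `&` [set i | expR (- U) <= a i] = S `&` level a D (expR U).
  rewrite /level; apply/seteqP; split=> i [Si /=]; rewrite -expRN.
    by move=> ai; split=> //; split=> //; exact: SD.
  by move=> [_ ai].
have fin : finite_set (S `&` level a D (expR U)).
  apply: (@sub_finite_set _ _ (level a D (expR U))); first exact: subIsetr.
  exact: (finite_level C0 countP (expR_gt0 U)).
set F := fset_set _ in tail.
have FE i : i \in F = (i \in S `&` level a D (expR U)) by rewrite in_fset_set.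
rewrite (@uprod_finite _ _ _ _ F); last by move=> i /mem_set /=; rewrite FE.
have -> : \prod_(i <- F | i \in S `&` level a D (expR U)) f i =
    \prod_(i <- F | i \in S) f i.
  rewrite big_seq_cond [RHS]big_seq_cond; apply: eq_bigl => i.
  by rewrite FE in_setI; case: (i \in S); rewrite /= ?andbF ?andbb ?andbT.
apply: (le_trans (relative_truncation_error fp tail pN0 _)); first by lra.
rewrite ler_pdivrMr; last by lra.
have by1 : 1 <= b * (1 - 2 * (b * s)).
  have bbV : b * b^-1 = 1 by rewrite divff// gt_eqF//; lra.
  have b0 : 0 <= b by lra.
  have sV : b^-1 <= 1 - 2 * (b * s) by lra.
  by have := ler_wpM2l b0 sV; rewrite bbV.
have bs0 : 0 <= b * s by apply: mulr_ge0; [lra|exact: ltW].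
by have := ler_wpM2l bs0 by1; rewrite -bb; lra.
Unshelve. all: by end_near. Qed.

End Truncation.

(** * The prime function *)

(** Includes the factor 1, whose potential is +oo. *)
Lemma potential_le (R : realType) (zeta alpha : R[i])
    (th : sphere R -> sphere R) (U : R) :
  (potential zeta alpha th <= U%:E)%E =
  (expR (- U) <= cmod (Rfactor zeta alpha th - 1)).
Proof.
rewrite /potential; have := cmod_ge0 (Rfactor zeta alpha th - 1).
rewrite le_eqVlt => /predU1P[<-|x0].
  by rewrite le0_lneNy//= leye_eq [RHS]leNgt expR_gt0.
by rewrite lne_EFin// -EFinN lee_fin lerNl -[in RHS](lnK x0) ler_expR.
Qed.

Theorem theorem6p2 (R : realType) (M : nat) (ctr : 'I_M -> R[i])
    (q : 'I_M -> R) (zeta alpha : R[i]) (delta C : R)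
    (S : set (sphere R -> sphere R))
    (hM : (1 <= M)%N)
    (hdata : circular_data ctr q)
    (hzeta : circular_domain ctr q zeta)
    (halpha : circular_domain ctr q alpha)
    (hneq : zeta <> alpha)
    (hS : half_system ctr q S)
    (hdelta : hausdorff_dim chordal (limit_set ctr q) = delta%:E)
    (hdelta01 : 0 < delta < 1)
    (hC : 0 < C)
    (hcount : (factor_count ctr q zeta alpha T)%:R / (C * T `^ delta)
                @[T --> +oo] --> (1 : R)) :
  exists2 h : R -> R,
    h U @[U --> +oo] --> (0 : R) &
    \forall U \near +oo,
      cmod (prime_function_trunc S U zeta alpha - prime_function S zeta alpha)
        / cmod (prime_function S zeta alpha)
      <= (1 + h U) * (C * delta / (1 - delta)) * expR (- ((1 - delta) * U)).
Proof.
have [SD _] := hS; have /andP[d0 d1] := hdelta01.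
pose E U :=
  cmod (prime_function_trunc S U zeta alpha - prime_function S zeta alpha)
    / cmod (prime_function S zeta alpha).
pose G U := C * delta / (1 - delta) * expR (- ((1 - delta) * U)).
have G0 U : 0 < G U by rewrite !mulr_gt0 ?invr_gt0 ?expR_gt0 ?subr_gt0.
have [|h h0 hE] := @cvg0_relative_excess _ E G G0; last first.
  by exists h => //; apply: filterS hE => U; rewrite /G mulrA.
move=> c c1.
apply: filterS (uprod_truncation_error SD hdelta01 hC hcount c1) => U.
apply: le_trans; rewrite /E /prime_function_trunc /prime_function.
have -> : [set th | (potential zeta alpha th <= U%:E)%E] =
    [set th | expR (- U) <= cmod (Rfactor zeta alpha th - 1)].
  by apply/seteqP; split=> th /=; rewrite potential_le.
rewrite -mulrBr !normcM invfM mulrACA divff ?mul1r//.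
by apply/eqP => /eq0_normc/eqP; rewrite subr_eq0 => /eqP.
Qed.
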